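(* Let $g\ge3$, $k\ge0$, and let $m,n\ge 1$ be odd integers. Then for non-negative integers $\alpha,\beta$, $\mathrm{HWP}(C_g[2^{k+2}mn];\, gm,\, 2^kgn;\,\alpha,\beta)$ has a solution if and only if $\alpha+\beta=2^{k+2}mn$.
   Context: $C_g[u]$ is the graph with vertices $x_{i,j}$, $i\in\mathbb{Z}_g$, $0\le j\le u-1$, and edges $x_{i,a}x_{i+1,b}$ for all $i\in\mathbb{Z}_g$ and $0\le a,b\le u-1$. A $C_\ell$-factor of a graph is a spanning subgraph all of whose components are cycles of length $\ell$. For integers $M,N\ge3$ and non-negative integers $\alpha,\beta$, a solution to $\mathrm{HWP}(G;M,N;\alpha,\beta)$ is a partition of the edge set of the graph $G$ into $\alpha$ $C_M$-factors and $\beta$ $C_N$-factors. *)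

(* Defs.v *)
From mathcomp Require Import all_boot.
Set Implicit Arguments. Unset Strict Implicit. Unset Printing Implicit Defensive.

(* A (simple) graph is given by a vertex finType V and an edge set
   E : {set {set V}} of 2-element subsets of V. *)

Definition Cg (g u : nat) : {set {set ('I_g * 'I_u)}} :=
  [set e : {set 'I_g * 'I_u} | [exists x : 'I_g * 'I_u, exists y : 'I_g * 'I_u,
      (e == [set x; y]) && (nat_of_ord y.1 == (nat_of_ord x.1).+1 %% g)]].

Definition cycle_edges (V : finType) (s : seq V) : {set {set V}} :=
  [set [set p.1; p.2] | p in zip s (rot 1 s)].

Definition is_cycle_seq (V : finType) (l : nat) (s : seq V) : Prop :=
  3 <= l /\ size s = l /\ uniq s.

Definition is_Cfactor (V : finType) (E : {set {set V}}) (l : nat)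
    (F : {set {set V}}) : Prop :=
  F \subset E /\
  exists cs : seq (seq V),
    (forall c, c \in cs -> is_cycle_seq l c) /\
    perm_eq (flatten cs) (enum V) /\
    F = \bigcup_(c <- cs) cycle_edges c.

Definition HWP (V : finType) (E : {set {set V}}) (M N alpha beta : nat) : Prop :=
  exists F : 'I_alpha + 'I_beta -> {set {set V}},
    (forall i : 'I_alpha, is_Cfactor E M (F (inl i))) /\
    (forall j : 'I_beta, is_Cfactor E N (F (inr j))) /\
    (forall x y, x <> y -> [disjoint F x & F y]) /\
    \bigcup_(x : 'I_alpha + 'I_beta) F x = E.

(* Main.v *)
Require Import Defs.
From Stdlib Require List.
From mathcomp Require Import all_boot all_algebra zify.

Set Implicit Arguments. Unset Strict Implicit. Unset Printing Implicit Defensive.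

Import GRing.Theory.

(* Necessity is a count of edges.  For sufficiency let w = 2^k m n and identify
   each layer with X = F_4 x B, where B = Z/w.  A family of permutations of X,
   one for each factor and each pair of consecutive layers, describes a
   partition of the edges if, between two given layers, every (p, q) in X x X
   is matched by exactly one factor; the cycles of a factor are then g times as
   long as those of the composite of its g permutations.  Inserting a family
   and then its inverse reduces g to 3 or 4.

   The factors are indexed by (c, t) in F_4 x B and shift the F_4-coordinate by
   c, omega c, omega^2 c, which add up to 0.  So the composite is
   (a, b) |-> (a, b + d(a)), and we want d(a) = x or -x (order m), respectively
   y or -y (order 2^k n), with a sign depending on a.  For fixed c this amounts
   to writing d as a sum of permutations of B in the variable t.  It is possible
   when d does not depend on t, and when d takes both values it is possible with
   any prescribed multiplicities except for one value of t, namely t = 0.  The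
   four factors with t = 0 shift by c, omega^2 c, omega c instead: as the signs
   of d(a) add up to 0 over F_4, this exchange absorbs the defect.

   If w is even and g is odd, no constant is a sum of g permutations of B.  Then
   the factors with t odd use the shifts c, omega (c + 1), omega^2 (c + omega^2),
   and, unless all factors have the same type, one class c contains a single
   factor of one of the two types, the one with t = 0. *)

(** * Cycle factors and their numbers of edges *)

Lemma set2_inj (T : finType) (a b c d : T) :
  [set a; b] = [set c; d] -> (a = c /\ b = d) \/ (a = d /\ b = c).
Proof.
move=> e.
have /set2P ha : a \in [set c; d] by rewrite -e set21.
have /set2P hb : b \in [set c; d] by rewrite -e set22.
have /set2P hc : c \in [set a; b] by rewrite e set21.
have /set2P hd : d \in [set a; b] by rewrite e set22.
by case: ha hb hc hd => -> [] -> [] ? [] ?; subst; auto.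
Qed.

Lemma rot1_fcycle (T : eqType) (f : T -> T) (c : seq T) :
  fcycle f c -> rot 1 c = map f c.
Proof.
case: c => //= x p; rewrite rot1_cons.
have aux (y : T) q : fpath f y q -> q = map f (belast y q).
  by elim: q y => //= z q IH y /andP[/eqP -> /IH {1}->].
by move/aux=> {1}->; rewrite belast_rcons.
Qed.

Lemma cycle_edgesE (V : finType) (f : V -> V) (c : seq V) :
  fcycle f c -> cycle_edges c = [set [set v; f v] | v in c].
Proof.
move=> fc; rewrite /cycle_edges (rot1_fcycle fc).
have -> : zip c (map f c) = map (fun v => (v, f v)) c.
  by elim: c {fc} => //= x c ->.
apply/setP => e; apply/imsetP/imsetP => -[].
  by move=> p /mapP[v vc ->] ->; exists v.
by move=> v vc ->; exists (v, f v) => //; apply/mapP; exists v.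
Qed.

(** Two vertices giving the same edge [[set v; next c v]] would be exchanged by [next c], hence lie
    on an orbit of length at most 2. *)
Lemma card_cycle_edges (V : finType) (l : nat) (c : seq V) :
  is_cycle_seq l c -> #|cycle_edges c| = size c.
Proof.
move=> [l3 [sc uc]].
have fc := cycle_next uc.
rewrite (cycle_edgesE fc) card_in_imset ?(card_uniqP uc) // => a b ac bc.
case/set2_inj => [[]//|[e1 e2]].
have := order_cycle fc uc ac.
have : order (next c) a <= size [:: a; b].
  by apply: (@order_le_cycle _ (next c)); rewrite ?inE ?eqxx //= -e1 -e2 !eqxx.
by move=> /[swap] ->; rewrite sc /=; move: l3; case: l {sc} => [|[|[]]].
Qed.


Lemma mem_zipP (S T : eqType) (s : seq S) (t : seq T) p :
  p \in zip s t -> (p.1 \in s) /\ (p.2 \in t).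
Proof.
elim: s t => [|x s IH] [|y t] //=; rewrite !inE.
by case/orP => [/eqP -> | /IH [-> ->]]; rewrite ?eqxx ?orbT.
Qed.

Lemma cycle_edges_sub (V : finType) (c : seq V) e v :
  e \in cycle_edges c -> v \in e -> v \in c.
Proof.
case/imsetP => -[a b] /mem_zipP /= []; rewrite mem_rot => ac bc -> /set2P.
by case=> ->.
Qed.

Lemma mem_bigcup_seq (I : eqType) (T : finType) (s : seq I) (F : I -> {set T}) x :
  reflect (exists2 i, i \in s & x \in F i) (x \in \bigcup_(i <- s) F i).
Proof.
elim: s => [|i s IH].
  by rewrite big_nil inE; apply: ReflectF => -[].
rewrite big_cons inE; apply: (iffP orP) => [[xi|/IH[j js xj]]|[j]].
- by exists i; rewrite ?inE ?eqxx.
- by exists j; rewrite // inE js orbT.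
by rewrite inE => /orP[/eqP-> ->|js xj]; [left | right; apply/IH; exists j].
Qed.

(** Distinct cycles share no vertex, hence no edge, and each has as many edges as vertices. *)
Lemma card_Cfactor (V : finType) E l (F : {set {set V}}) :
  is_Cfactor E l F -> #|F| = #|V|.
Proof.
move=> [_ [cs [hcs [pe ->]]]].
have uf : uniq (flatten cs) by rewrite (perm_uniq pe) enum_uniq.
transitivity (size (flatten cs)); last by rewrite (perm_size pe) -cardE.
elim: cs hcs uf {pe} => [|c cs IH] hcs /=; first by rewrite big_nil cards0.
rewrite cat_uniq => /and3P[uc hd uf].
have hc : is_cycle_seq l c by apply: hcs; rewrite inE eqxx.
rewrite big_cons cardsU (card_cycle_edges hc) IH // ?size_cat; last first.
  by move=> d dc; apply: hcs; rewrite inE dc orbT.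
suff -> : cycle_edges c :&: \bigcup_(d <- cs) cycle_edges d = set0.
  by rewrite cards0 subn0.
apply/setP => e; rewrite !inE; apply/negP => /andP[ec].
case/mem_bigcup_seq=> d dc ed.
have [v ve] : exists v, v \in e.
  by case/imsetP: ec => p _ ->; exists p.1; rewrite set21.
move/hasP: hd; apply; exists v; last exact: cycle_edges_sub ec ve.
by apply/flattenP; exists d => //; apply: cycle_edges_sub ed ve.
Qed.

(** The cycles are the orbits of [f], one for each element of [froots f]. *)
Lemma is_Cfactor_perm (V : finType) (E : {set {set V}}) l (f : V -> V) :
  3 <= l -> injective f -> (forall v, order f v = l) ->
  (forall v, [set v; f v] \in E) ->
  is_Cfactor E l [set [set v; f v] | v in [set: V]].
Proof.
move=> l3 fi fo fE; split.
  by apply/subsetP => e /imsetP[v _ ->].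
have symf : connect_sym (frel f) by exact: fconnect_sym.
pose cs := [seq orbit f x | x <- enum (froots f)].
have hcs c : c \in cs -> is_cycle_seq l c /\ fcycle f c.
  case/mapP => x _ ->; split; last exact: cycle_orbit.
  by split=> //; rewrite size_orbit orbit_uniq fo.
have mem_cs v : orbit f (froot f v) \in cs.
  by apply: map_f; rewrite mem_enum; apply: roots_root.
have mem_orb v : v \in orbit f (froot f v).
  by rewrite -fconnect_orbit symf connect_root.
exists cs; split; first by move=> c /hcs [].
split; last first.
  apply/setP => e; apply/imsetP/mem_bigcup_seq.
    move=> [v _ ->]; exists (orbit f (froot f v)) => //.
    have [_ fc] := hcs _ (mem_cs v).
    by rewrite (cycle_edgesE fc); apply/imsetP; exists v.
  move=> [c cc]; have [_ fc] := hcs _ cc.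
  by rewrite (cycle_edgesE fc) => /imsetP[v _ ->]; exists v.
apply: uniq_perm; rewrite ?enum_uniq //; last first.
  move=> v; rewrite mem_enum; apply/flattenP.
  by exists (orbit f (froot f v)).
rewrite /cs.
have : all (froots f) (enum (froots f)).
  by apply/allP => x; rewrite mem_enum.
have := enum_uniq (froots f); elim: (enum _) => //= x s IH /andP[xs us].
move=> /andP[rx rs]; rewrite cat_uniq orbit_uniq IH // andbT /=.
apply/hasPn => v /flattenP[c /mapP[y ys ->]].
rewrite -!fconnect_orbit => yv; apply: contra xs => xv.
suff -> : x = y by [].
have ry : froots f y by apply: (allP rs).
rewrite -(eqP rx) -(eqP ry); apply/eqP.
by rewrite root_connect //; apply: connect_trans xv _; rewrite symf.
Qed.

Lemma card_HWP (V : finType) (E : {set {set V}}) M N alpha beta :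
  HWP E M N alpha beta -> #|E| = (alpha + beta) * #|V|.
Proof.
move=> [F [hM [hN [dF <-]]]].
rewrite -sum1_card partition_disjoint_bigcup; last first.
  by move=> x y /eqP; apply: dF.
rewrite (eq_bigr (fun=> #|V|)); last first.
  by move=> [i|i] _; rewrite sum1_card; [apply: card_Cfactor (hM i) | apply: card_Cfactor (hN i)].
by rewrite sum_nat_const card_sum !card_ord.
Qed.

(** * Edges of [Cg g u] and necessity *)

Lemma next_ord_proof g (i : 'I_g) : i.+1 %% g < g.
Proof. by rewrite ltn_mod; case: g i => // -[]. Qed.
Definition next_ord g (i : 'I_g) : 'I_g := Ordinal (next_ord_proof i).

Lemma next_ord_ord2 g (i : 'I_g) : 2 < g -> next_ord (next_ord i) != i.
Proof.
move=> g3; apply/eqP => /(congr1 val) /= e.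
have : i.+2 = i %[mod g] by rewrite -{2}e modn_mod -[(i.+1 %% g).+1]addn1 modnDml addn1.
rewrite -{2}[val i]addn0 -[i.+2]addn2 => /eqP; rewrite eqn_modDl mod0n.
by rewrite modn_small.
Qed.

Lemma next_ord_inj g : injective (@next_ord g).
Proof.
move=> i j /(congr1 val) /= /eqP; rewrite -[i.+1]addn1 -[j.+1]addn1.
by rewrite eqn_modDr !modn_small // => /eqP /val_inj.
Qed.

Lemma CgP g u e :
  reflect (exists v : 'I_g * 'I_u, exists y, e = [set v; (next_ord v.1, y)])
          (e \in Cg g u).
Proof.
rewrite inE; apply: (iffP existsP).
  move=> [v /existsP[[z1 z2] /andP[/eqP -> /= /eqP e1]]]; exists v, z2.
  by congr [set _; (_, _)]; apply: val_inj.
move=> [v [y ->]]; exists v; apply/existsP; exists (next_ord v.1, y).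
by rewrite eqxx /=.
Qed.

(** For [2 < g] an edge leads to the next layer from only one of its ends, so it determines its
    orientation. *)
Lemma Cg_edge_inj g u (v w : 'I_g * 'I_u) y z : 2 < g ->
  [set v; (next_ord v.1, y)] = [set w; (next_ord w.1, z)] -> v = w /\ y = z.
Proof.
move=> g3 /set2_inj [[-> [->]]//|[e1 e2]].
by have := next_ord_ord2 w.1 g3; rewrite -{2}e2 e1 eqxx.
Qed.

Lemma card_Cg g u : 2 < g -> #|Cg g u| = u * (g * u).
Proof.
move=> g3.
pose h (p : ('I_g * 'I_u) * 'I_u) := [set p.1; (next_ord p.1.1, p.2)].
have -> : Cg g u = [set h p | p in [set: _]].
  apply/setP => e; apply/CgP/imsetP; first by move=> [v [y ->]]; exists (v, y).
  by move=> [[v y] _ ->]; exists v, y.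
rewrite card_imset ?cardsT ?card_prod ?card_ord 1?mulnC //.
by move=> [v y] [w z] /(Cg_edge_inj g3) /= [-> ->].
Qed.

Lemma HWP_Cg_card g u M N alpha beta : 2 < g -> 0 < u ->
  HWP (Cg g u) M N alpha beta -> alpha + beta = u.
Proof.
move=> g3 u0 /card_HWP; rewrite card_Cg // card_prod !card_ord => /esym/eqP.
by rewrite eqn_pmul2r ?muln_gt0 ?u0 ?andbT ?(ltn_trans _ g3) // => /eqP.
Qed.

(** * From Latin families of permutations to factorizations *)

Definition latin (F X : Type) (L : F -> X -> X) : Prop :=
  (forall f, injective (L f)) /\ (forall x, injective (L^~ x)).

Definition comp_layers (F X : Type) (Ls : seq (F -> X -> X)) (f : F) (x : X) :=
  foldl (fun y L => L f y) x Ls.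

(** The divisibility form of having all cycles of length [l]; it compares directly with the
    vanishing of multiples in an abelian group. *)
Definition all_orbits (X : Type) (l : nat) (D : X -> X) : Prop :=
  forall x j, iter j D x = x <-> l %| j.

Lemma order_all_orbits (T : finType) (f : T -> T) l v :
  injective f -> 0 < l -> (forall j, iter j f v = v <-> l %| j) ->
  order f v = l.
Proof.
move=> fi l0 h; apply/eqP; rewrite eqn_leq; apply/andP; split; last first.
  by rewrite dvdn_leq ?order_gt0 //; apply/h/iter_order.
rewrite leqNgt; apply/negP => lt.
have e : iter l f v = v by apply/h.
have := nth_uniq v _ _ (orbit_uniq f v); rewrite size_orbit => /(_ _ 0 lt).
rewrite order_gt0 => /(_ isT); rewrite /orbit !nth_traject ?order_gt0 //= e eqxx.
by case: l l0 {h lt e}.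
Qed.

Section Layers.
Variables (F : finType) (g u : nat) (Ls : seq (F -> 'I_u -> 'I_u)).
Hypotheses (g3 : 2 < g) (sL : size Ls = g).
Hypothesis latL : forall L, List.In L Ls -> latin L.

Let id_layer : F -> 'I_u -> 'I_u := fun _ x => x.

Definition layer_step (f : F) (v : 'I_g * 'I_u) : 'I_g * 'I_u :=
  (next_ord v.1, nth id_layer Ls v.1 f v.2).

Lemma latin_nth (i : 'I_g) : latin (nth id_layer Ls i).
Proof.
apply: latL; have : i < size Ls by rewrite sL.
elim: Ls (val i) => [|L s IH] [|j] //= js; [by left | by right; apply: IH].
Qed.

Lemma layer_step_inj f : injective (layer_step f).
Proof.
move=> [i x] [j y] [/eqP]; rewrite -[_ == _]/(val (next_ord i) == val (next_ord j)).
move=> /eqP /val_inj /next_ord_inj <-.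
by move=> /(proj1 (latin_nth i) f) ->.
Qed.

Lemma iter_layer_step1 f k v : (iter k (layer_step f) v).1 = (v.1 + k) %% g :> nat.
Proof.
elim: k => [|k IH]; first by rewrite addn0 modn_small.
by rewrite iterS /= IH -addn1 modnDml addn1 addnS.
Qed.

Lemma iter_layer_step0 f k (o : 'I_g) x : val o = 0 -> k <= g ->
  (iter k (layer_step f) (o, x)).2 = comp_layers (take k Ls) f x.
Proof.
move=> o0; elim: k => [|k IH] kg; first by rewrite take0.
rewrite iterS /= IH ?(ltnW kg) // iter_layer_step1 o0 add0n modn_small //.
by rewrite (take_nth id_layer) ?sL // /comp_layers foldl_rcons.
Qed.

Lemma iter_layer_step_g f j (o : 'I_g) x : val o = 0 ->
  iter (g * j) (layer_step f) (o, x) = (o, iter j (comp_layers Ls f) x).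
Proof.
move=> o0; rewrite mulnC; elim: j => [//|j IH].
rewrite mulSn iterD IH iterS [LHS]surjective_pairing; congr pair.
  by apply: val_inj; rewrite [LHS]iter_layer_step1 /= o0 add0n modnn.
by rewrite iter_layer_step0 // -sL take_size.
Qed.

(** The layer index forces the period to be a multiple of [g], and [g] steps from layer 0 apply the
    composite once. Any other vertex reaches layer 0 along its own orbit. *)
Lemma order_layer_step f l v : 0 < l -> all_orbits l (comp_layers Ls f) ->
  order (layer_step f) v = g * l.
Proof.
move=> l0 h; have g0 : 0 < g by apply: leq_trans g3.
apply: order_all_orbits; [exact: layer_step_inj | by rewrite muln_gt0 g0|].
pose o := Ordinal g0; move=> j.
have [x ex] : exists x, iter (g - v.1) (layer_step f) v = (o, x).
  exists (iter (g - v.1) (layer_step f) v).2.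
  rewrite [LHS]surjective_pairing; congr pair; apply: val_inj.
  by rewrite [LHS]iter_layer_step1 /= subnKC ?modnn // ltnW.
have -> : iter j (layer_step f) v = v <-> iter j (layer_step f) (o, x) = (o, x).
  rewrite -ex -iterD addnC iterD; split=> [-> //|].
  by elim: (g - v.1) => //= n IH /layer_step_inj.
split=> [e|/dvdnP[q ->]]; last first.
  rewrite mulnCA iter_layer_step_g //; congr pair; apply/h; exact: dvdn_mull.
have : g %| j.
  move: (congr1 (fun p => val p.1) e) => /=.
  by rewrite iter_layer_step1 add0n => /eqP.
move=> /dvdnP[q qj]; move: e; rewrite qj mulnC iter_layer_step_g // => -[].
by move/h; rewrite dvdn_pmul2l.
Qed.

(** Since [F] has [u] elements, the second half of [latin] becomes bijectivity: each edge between
    consecutive layers lies in exactly one factor. *)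
Lemma HWP_layers_ord (tp : pred F) M N : #|F| = u -> 0 < M -> 0 < N ->
  (forall f, all_orbits (if tp f then M else N) (comp_layers Ls f)) ->
  HWP (Cg g u) (g * M) (g * N) #|tp| #|predC tp|.
Proof.
move=> cF M0 N0 h; have g0 : 0 < g by apply: leq_trans g3.
pose ix (z : 'I_#|tp| + 'I_#|predC tp|) : F :=
  match z with inl i => enum_val i | inr i => enum_val i end.
have ixi : injective ix.
  move=> [i|i] [j|j] /= e.
  - by congr inl; apply: enum_val_inj.
  - have ti : tp (enum_val i) := enum_valP i.
    by have := enum_valP j; rewrite -e inE /= ti.
  - have tj : tp (enum_val j) := enum_valP j.
    by have := enum_valP i; rewrite e inE /= tj.
  - by congr inr; apply: enum_val_inj.
have ixs f : exists z, ix z = f.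
  case tf : (f \in tp); first by exists (inl (enum_rank_in tf f)); rewrite /= enum_rankK_in.
  have tf' : f \in predC tp by rewrite inE /= -[tp f]/(f \in tp) tf.
  by exists (inr (enum_rank_in tf' f)); rewrite /= enum_rankK_in.
pose G f := [set [set v; layer_step f v] | v in [set: 'I_g * 'I_u]].
have fac l f : 0 < l -> all_orbits l (comp_layers Ls f) ->
    is_Cfactor (Cg g u) (g * l) (G f).
  move=> l0 hf; apply: is_Cfactor_perm.
  - by apply: leq_trans g3 _; rewrite leq_pmulr.
  - exact: layer_step_inj.
  - by move=> v; apply: order_layer_step.
  - by move=> v; apply/CgP; exists v, (layer_step f v).2.
exists (fun z => G (ix z)); split.
  by move=> i; apply: fac => //; have := h (ix (inl i));
  have ti : tp (enum_val i) := enum_valP i; rewrite /= ti.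
split.
  move=> i; apply: fac => //; have := h (ix (inr i)).
  by have := enum_valP i; rewrite inE /= => /negbTE ->.
split.
  move=> y z yz; rewrite -setI_eq0; apply/eqP/setP => e; rewrite !inE.
  apply/negP => /andP[/imsetP[v _ ->] /imsetP[w _ /(Cg_edge_inj g3)]].
  by case=> <- /(proj2 (latin_nth v.1) v.2) /ixi.
apply/setP => e; apply/bigcupP/CgP.
  by move=> [z _ /imsetP[v _ ->]]; exists v, (layer_step (ix z) v).2.
move=> [v [y ->]].
have cc : #|'I_u| <= #|F| by rewrite cF card_ord.
have /codomP[f ->] : y \in codom ((nth id_layer Ls v.1)^~ v.2).
  by apply: inj_card_onto; [exact: (proj2 (latin_nth v.1)) | rewrite cF card_ord].
have [z <-] := ixs f; exists z => //; by apply/imsetP; exists v.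
Qed.
End Layers.

Lemma HWP_layers (F X : finType) g u (Ls : seq (F -> X -> X)) (tp : pred F) M N :
  2 < g -> size Ls = g -> (forall L, List.In L Ls -> latin L) ->
  #|F| = u -> #|X| = u -> 0 < M -> 0 < N ->
  (forall f, all_orbits (if tp f then M else N) (comp_layers Ls f)) ->
  HWP (Cg g u) (g * M) (g * N) #|tp| #|predC tp|.
Proof.
move=> g3 sL lL cF cX M0 N0 h.
pose r (x : X) : 'I_u := cast_ord cX (enum_rank x).
pose r' (i : 'I_u) : X := enum_val (cast_ord (esym cX) i).
have rK : cancel r r' by move=> x; rewrite /r /r' cast_ordK enum_rankK.
have rK' : cancel r' r by move=> i; rewrite /r /r' enum_valK cast_ordKV.
pose conj (L : F -> X -> X) f i := r (L f (r' i)).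
have cj f i : comp_layers [seq conj L | L <- Ls] f i = r (comp_layers Ls f (r' i)).
  rewrite /comp_layers; elim: (Ls) i => [|L s IH] i /=; first by rewrite rK'.
  by rewrite IH /conj rK.
have itc f i j : iter j (comp_layers [seq conj L | L <- Ls] f) i
                 = r (iter j (comp_layers Ls f) (r' i)).
  by elim: j => [|j IH] /=; rewrite ?rK' // IH cj rK.
apply: (@HWP_layers_ord _ _ _ [seq conj L | L <- Ls]) => //.
- by rewrite size_map.
- move=> L; elim: Ls lL {sL h cj itc} => //= L' s IH lL [<-|]; last first.
    by apply: IH => L'' ?; apply: lL; right.
  have [l1 l2] := lL _ (or_introl erefl); split=> [f i j|i f f'].
    by move/(can_inj rK)/l1/(can_inj rK').
  by move/(can_inj rK)/l2.
- move=> f i j; rewrite itc -(h f (r' i) j); split=> [e|-> //].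
  by rewrite -[in RHS]e rK.
Qed.

(* Appending [P] and then its inverse leaves every composite unchanged. *)
Lemma latin_layers_add2 (F X : finType) (Ls : seq (F -> X -> X)) (D : F -> X -> X) :
  0 < size Ls -> (forall L, List.In L Ls -> latin L) -> comp_layers Ls =2 D ->
  exists Ls' : seq (F -> X -> X), [/\ size Ls' = (size Ls).+2,
    forall L, List.In L Ls' -> latin L & comp_layers Ls' =2 D].
Proof.
case: Ls => // P s _ lL cD.
have [p1 p2] := lL P (or_introl erefl).
pose Q f x := invF (p1 f) x.
exists (Q :: P :: P :: s); split=> // [L|f x].
  case=> [<-|[<-|]]; [|by split|exact: lL].
  split=> [f|x f f']; first by apply: can_inj (f_invF (p1 f)).
  move=> e; apply: (p2 (Q f x)).
  by rewrite /= [in RHS]e /Q !f_invF.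
by rewrite -cD /comp_layers /= f_invF.
Qed.

Lemma latin_layers_extend (F X : finType) (D : F -> X -> X) n
    (Ls : seq (F -> X -> X)) :
  0 < size Ls -> (forall L, List.In L Ls -> latin L) -> comp_layers Ls =2 D ->
  exists Ls' : seq (F -> X -> X), [/\ size Ls' = size Ls + n.*2,
    forall L, List.In L Ls' -> latin L & comp_layers Ls' =2 D].
Proof.
elim: n Ls => [|n IH] Ls s0 lL cD; first by exists Ls; rewrite addn0.
have [Ls1 [s1 l1 c1]] := latin_layers_add2 s0 lL cD.
have [|Ls2 [s2 l2 c2]] := IH Ls1 _ l1 c1; first by rewrite s1.
by exists Ls2; split=> //; rewrite s2 s1 doubleS !addnS.
Qed.

(* The additive group of the field with four elements, the pair [(p, q)]
   standing for [p + q * omega]; [om] and [om2] are the multiplications by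
   [omega] and by its square. *)
Notation f4 := (bool * bool)%type.
Definition add4 (a b : f4) : f4 := (a.1 (+) b.1, a.2 (+) b.2).
Definition om (a : f4) : f4 := (a.2, a.1 (+) a.2).
Definition om2 (a : f4) : f4 := (a.1 (+) a.2, a.1).

Lemma add4A a b c : add4 a (add4 b c) = add4 (add4 a b) c.
Proof. by case: a b c => [[] []] [[] []] [[] []]. Qed.
Lemma add4I a : injective (add4 a).
Proof. by case: a => [[] []] [[] []] [[] []]. Qed.
Lemma add4Ir a : injective (add4^~ a).
Proof. by case: a => [[] []] [[] []] [[] []]. Qed.
Lemma om_inj : injective om.
Proof. by case=> [[] []] [[] []]. Qed.
Lemma om2_inj : injective om2.
Proof. by case=> [[] []] [[] []]. Qed.
Lemma add4_om a : add4 a (om a) = om2 a.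
Proof. by case: a => [[] []]. Qed.


Local Open Scope ring_scope.

(** * Layers over F_4 x B *)

Section Core.
Variable B : finZmodType.

(** [k] renames the class of a factor separately for each [t]; the increment [G] depends on the
    entering F_4-coordinate, the new class and [t]. *)
Definition shift_layer (k : f4 -> B -> f4) (s : f4 -> f4)
    (G : f4 -> f4 -> B -> B) (f x : f4 * B) : f4 * B :=
  (add4 x.1 (s (k f.1 f.2)), x.2 + G x.1 (k f.1 f.2) f.2).

(** Two consecutive positions reveal the renamed class from the F_4-shift, then [t] from the
    increment, then the class itself by undoing [k] at [t]. *)
Lemma latin_shift_layer k s G : (forall t, injective (k^~ t)) -> injective s ->
  (forall a q, injective (G a q)) -> latin (shift_layer k s G).
Proof.
move=> ki si Gi; split=> [[c t] [a b] [a' b']|[a b] [c t] [c' t']] /pair_equal_spec /=.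
  by case=> /add4Ir <- /addIr ->.
case=> /add4I/si e; rewrite e => /addrI/Gi et; rewrite et in e *.
by rewrite (ki t' _ _ e).
Qed.

(** [k1] and [k2] are tied so that the shifts cancel. Three layers serve odd [g]; for even [g] the
    last shift is split as [om2 q = q + om q] over two layers, so [G2] need only be a sum of two
    permutations. [G2] is indexed by the starting F_4-coordinate, and so is [G1] when
    [k1 c t = c]. *)
Lemma HWP_shift_layers (g u M N : nat) (k1 k2 : f4 -> B -> f4)
    (G0 G1 G2 R S D : f4 -> f4 -> B -> B) (tp : pred (f4 * B)) :
  (2 < g)%N -> (4 * #|B|)%N = u -> (0 < M)%N -> (0 < N)%N ->
  (forall t, injective (k1^~ t)) -> (forall t, injective (k2^~ t)) ->
  (forall c t, add4 c (om (k1 c t)) = om2 (k2 c t)) ->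
  (forall a q, injective (G0 a q)) -> (forall a q, injective (G1 a q)) ->
  (if odd g then forall a q, injective (G2 a q) else
     [/\ forall a q, injective (R a q), forall a q, injective (S a q)
       & forall a q t, G2 a q t = R a q t + S a q t]) ->
  (forall a c t, G0 a c t + G1 (add4 (add4 a c) (k1 c t)) (k1 c t) t
     + G2 a (k2 c t) t = D a c t) ->
  (forall a c t j, D a c t *+ j = 0 <-> ((if tp (c, t) then M else N) %| j)%N) ->
  HWP (Cg g u) (g * M) (g * N) #|tp| #|predC tp|.
Proof.
move=> g3 cu M0 N0 k1i k2i h12 G0i G1i hg hD ord.
have cX : #|{: f4 * B}| = u by rewrite card_prod card_prod card_bool cu.
pose comp (f x : f4 * B) := (x.1, x.2 + D x.1 f.1 f.2).
have [Ls [sL lL cL]] : exists Ls, [/\ size Ls = g,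
    forall L, List.In L Ls -> latin L & comp_layers Ls =2 comp].
  pose L0 := shift_layer (fun c _ => c) id G0.
  pose L1 := shift_layer k1 om (fun a q => G1 (add4 a q) q).
  have l0 : latin L0 by apply: latin_shift_layer => // t x y.
  have l1 : latin L1 by apply: latin_shift_layer => //; exact: om_inj.
  move: hg; case: ifP => go => [G2i | [Ri Si RS]].
    pose L2 := shift_layer k2 om2 (fun a q => G2 (add4 a (om2 q)) q).
    have l2 : latin L2 by apply: latin_shift_layer => //; exact: om2_inj.
    have [| | |Ls [sL lL cL]] := @latin_layers_extend _ _ comp (g./2.-1) [:: L0; L1; L2].
    - by [].
    - by move=> L [|[|[]]] // <-.
    - move=> [c t] [a b]; rewrite /comp_layers /= /L0 /L1 /L2 /shift_layer /comp /=.
      have -> : add4 (add4 a c) (om (k1 c t)) = add4 a (om2 (k2 c t)).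
        by rewrite -add4A h12.
      have aa q : add4 (add4 a q) q = a by case: a q => [[] []] [[] []].
      by rewrite !aa -hD !addrA.
    exists Ls; split=> //; rewrite sL /= -[in RHS](odd_double_half g) go.
    have : (0 < g./2)%N by rewrite half_gt0 ltnW.
    by case: g./2 => // h _; rewrite doubleS !addSn add0n.
  pose L2 := shift_layer k2 id (fun a q => R (add4 a (om2 q)) q).
  pose L3 := shift_layer k2 om (fun a q => S (add4 a (om q)) q).
  have l2 : latin L2 by apply: latin_shift_layer => // x y.
  have l3 : latin L3 by apply: latin_shift_layer => //; exact: om_inj.
  have [| | |Ls [sL lL cL]] := @latin_layers_extend _ _ comp (g./2.-2) [:: L0; L1; L2; L3].
  - by [].
  - by move=> L [|[|[|[]]]] // <-.
  - move=> [c t] [a b]; rewrite /comp_layers /= /L0 /L1 /L2 /L3 /shift_layer /comp /=.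
    have -> : add4 (add4 a c) (om (k1 c t)) = add4 a (om2 (k2 c t)).
      by rewrite -add4A h12.
    have aa q : add4 (add4 a q) q = a by case: a q => [[] []] [[] []].
    by rewrite -!(add4A _ (k2 c t)) add4_om !aa -hD RS !addrA.
  exists Ls; split=> //; rewrite sL /= -[in RHS](odd_double_half g) go.
  have : (1 < g./2)%N by move: g3 go; case: (g) => [|[|[|[]]]].
  by case: g./2 => [|[|h]] // _; rewrite !doubleS !addSn add0n.
apply: (HWP_layers g3 sL lL cX cX M0 N0) => -[c t] [a b] j.
have it i : iter i (comp_layers Ls (c, t)) (a, b) = (a, b + D a c t *+ i).
  elim: i => [|i IH]; first by rewrite mulr0n addr0.
  by rewrite iterS IH cL /comp /= mulrSr addrA.
rewrite it -(ord a c t); split=> [[]/eqP|->]; last by rewrite addr0.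
by rewrite -[X in _ == X]addr0 => /eqP /addrI.
Qed.
End Core.

(** * Permutations prescribed except at one point *)

Lemma almost_closed_set (T : finType) (h : T -> T) (x0 : T) r : (r <= #|T|)%N ->
  exists (U : {set T}) t0, #|U| = r /\
    forall t, t \in U -> t != t0 -> h t \in U.
Proof.
elim: r => [_|r IH rT]; first by exists set0, x0; split=> [|t]; rewrite ?cards0 ?inE.
have [U [t0 [cU hU]]] := IH (ltnW rT).
have addU t : t \notin U -> #|t |: U| = r.+1 by rewrite cardsU1 => ->; rewrite cU.
(* A missing [h t0] is added and becomes the new exception; otherwise [U] is closed under [h] and
   any fresh element may be added. *)
case: (boolP ((t0 \in U) && (h t0 \notin U))) => [/andP[t0U ht0]|/nandP ht0].
  exists (h t0 |: U), (h t0); split=> [|t]; first exact: addU.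
  rewrite !inE => /predU1P[->|tU]; rewrite ?eqxx // => _.
  by have [->|/(hU t tU) ->] := eqVneq t t0; rewrite ?eqxx ?orbT.
have [t tU] : exists t, t \notin U.
  have /card_gt0P[t] : (0 < #|~: U|)%N by rewrite cardsCs setCK cU subn_gt0.
  by rewrite inE => ?; exists t.
exists (t |: U), t; split=> [|s]; first exact: addU.
rewrite !inE => /predU1P[->|sU]; rewrite ?eqxx // => _.
have [e|/(hU s sU) ->] := eqVneq s t0; last by rewrite orbT.
by move: ht0; rewrite -e sU negbK => -[//|->]; rewrite orbT.
Qed.

(** The other elements have too few images to cover [T], so [t0] can take an omitted value. *)
Lemma inj_except_extend (T : finType) (f : T -> T) (t0 : T) :
  {in predC1 t0 &, injective f} ->
  exists p : T -> T, injective p /\ forall t, t != t0 -> p t = f t.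
Proof.
move=> fi.
have [z hz] : exists z, z \notin [set f t | t in predC1 t0].
  have /card_gt0P[z] : (0 < #|~: [set f t | t in predC1 t0]|)%N.
    rewrite cardsCs setCK subn_gt0 card_in_imset // cardC1.
    by rewrite prednK //; apply/card_gt0P; exists t0.
  by rewrite inE => ?; exists z.
have nz t : t != t0 -> f t != z.
  by move=> tt; apply: contraNneq hz => <-; apply/imsetP; exists t.
exists (fun t => if t == t0 then z else f t); split=> [s t|t /negbTE -> //].
have [->|st] := eqVneq s t0; have [->|tt] := eqVneq t t0 => // /eqP.
- by rewrite eq_sym (negbTE (nz _ tt)).
- by rewrite (negbTE (nz _ st)).
by move/eqP; apply: fi.
Qed.


(* [t + x] and [s + y] collide exactly when [s = t + (x - y)]. *)
Lemma mixed_shift (B : finZmodType) (x y : B) r : (r <= #|B|)%N ->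
  exists (U : {set B}) (p : B -> B), [/\ #|U| = r, injective p
    & forall t, t != 0 -> p t = t + (if t \in U then x else y)].
Proof.
move=> /(almost_closed_set (fun t => t + (x - y)) 0) [U [t0 [cU hU]]].
have sub_inj : injective (fun t : B => t - t0) by apply: addIr.
(* Translation moves the exceptional element to 0, so adding [x - y] leads out of [V] from 0 at
   most. *)
pose V := [set t - t0 | t in U].
have inV t : (t \in V) = (t + t0 \in U).
  apply/imsetP/idP => [[s sU ->]|tU]; first by rewrite subrK.
  by exists (t + t0); rewrite // addrK.
have hV t : t \in V -> t != 0 -> t + (x - y) \in V.
  rewrite !inV => tU t0'; rewrite addrAC; apply: hU => //.
  by apply: contra t0' => /eqP e; rewrite -(addrK t0 t) e subrr.
have [|p [pi hp]] := @inj_except_extend _ (fun t => t + (if t \in V then x else y)) 0.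
  move=> s t; rewrite !inE => s0 tn0.
  case: (boolP (s \in V)) => sV; case: (boolP (t \in V)) => tV; try exact: addIr.
    move=> e; have := hV s sV s0; rewrite addrA e addrK (negbTE tV) //.
  by move=> e; have := hV t tV tn0; rewrite addrA -e addrK (negbTE sV).
by exists V, p; rewrite card_imset.
Qed.

(** * Signs on F_4 and correction terms *)

Definition sg4 (B : zmodType) (a : f4) (v : B) : B := if a.2 then - v else v.

Lemma sg4_inj (B : zmodType) a : injective (@sg4 B a).
Proof. by rewrite /sg4 => v w; case: ifP => // _ /oppr_inj. Qed.

Section Tables.
Variables (B : zmodType) (th j u : B).

(** Integer coefficient triples turn identities valid for all [th], [j], [u] into finite
    computations. *)
Definition lin3 (p : int * int * int) : B := th *~ p.1.1 + j *~ p.1.2 + u *~ p.2.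

Definition table3 := seq (seq (int * int * int)).
(** The tables list F_4 in the order 0, 1, omega, omega^2. *)
Definition f4code (a : f4) : nat := (a.1 + a.2.*2)%N.
Definition lookup3 (s : table3) (a c : f4) : int * int * int :=
  nth (0, 0, 0) (nth [::] s (f4code a)) (f4code c).

(* The two tables solve the linear systems [mu_slot] and [mu_odd] simultaneously
   and were found by computer.  Here [th] is the defect of the mixed class, [j]
   the difference between the two values in the class with a single exception,
   and [u] the sum of the correction terms at odd [t]. *)
Definition mu1_table : table3 :=
  [:: [:: (-1, 1, -1); (0, 0, 0); (0, 0, 0); (0, 0, 0)];
      [:: (0, 1, -1); (-1, 0, 0); (0, 0, 0); (0, 0, 0)];
      [:: (0, 0, 1); (1, 0, 0); (0, 1, 0); (0, 0, 0)];
      [:: (1, 0, 1); (0, 0, 0); (0, 1, 0); (0, 0, 0)]].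
Definition mu2_table : table3 :=
  [:: [:: (1, -1, 2%:Z); (0, 1, 0); (0, 0, 0); (1, 0, 0)];
      [:: (0, -1, 2%:Z); (0, 1, 0); (0, 0, 0); (0, 0, 0)];
      [:: (0, 0, - 2%:Z); (0, 0, 0); (0, 0, 0); (0, 0, 0)];
      [:: (-1, 0, - 2%:Z); (0, 0, 0); (0, 0, 0); (-1, 0, 0)]].
(** The defects to be absorbed at [t = 0]: [th] in the mixed class 1 and [j] in class omega. *)
Definition slot_table : seq (int * int * int) :=
  [:: (0, 0, 0); (1, 0, 0); (0, 1, 0); (0, 0, 0)].
(** Adding [u] to these entries gives 0, 0, [u + j] and [3u - j], all even residues modulo an even
    number when [u] and [j] are odd. *)
Definition odd_table : seq (int * int * int) :=
  [:: (0, 0, -1); (0, 0, -1); (0, 1, 0); (0, -1, 2%:Z)].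

Definition mu1 a c := lin3 (lookup3 mu1_table a c).
Definition mu2 a c := lin3 (lookup3 mu2_table a c).
Definition slot_gap (c : f4) := lin3 (nth (0, 0, 0) slot_table (f4code c)).
Definition odd_gap (c : f4) := lin3 (nth (0, 0, 0) odd_table (f4code c)).

Definition add3 (p q : int * int * int) : int * int * int :=
  (p.1.1 + q.1.1, p.1.2 + q.1.2, p.2 + q.2).
Definition opp3 (p : int * int * int) : int * int * int :=
  (- p.1.1, - p.1.2, - p.2).

Lemma lin3D p q : lin3 p + lin3 q = lin3 (add3 p q).
Proof. by rewrite /lin3 /= !mulrzDr addrACA [X in X + _]addrACA. Qed.
Lemma lin3N p : - lin3 p = lin3 (opp3 p).
Proof. by rewrite /lin3 /= !mulrNz !opprD. Qed.

(** The left side is what remains of corrections subtracted in the first layer and restored in the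
    next two, when the classes there are [om c] and [om2 c], as at [t = 0]. *)
Lemma mu_slot a c :
  mu1 (add4 (add4 a c) (om c)) (om c) + mu2 a (om2 c) - mu1 a c - mu2 a c
  = sg4 a (slot_gap c).
Proof.
rewrite /sg4 /mu1 /mu2 /slot_gap !(lin3N, lin3D).
by case: a c => [[] []] [[] []] /=; congr lin3; apply/eqP; vm_compute.
Qed.

Definition one4 : f4 := (true, false).

(** The same remainder for the classes [c + 1] and [c + omega^2], used at odd [t]. *)
Lemma mu_odd a c :
  mu1 (add4 (add4 a c) (add4 c one4)) (add4 c one4) + mu2 a (add4 c (true, true))
    - mu1 a c - mu2 a c
  = sg4 a (odd_gap c).
Proof.
rewrite /sg4 /mu1 /mu2 /odd_gap !(lin3N, lin3D).
by case: a c => [[] []] [[] []] /=; congr lin3; apply/eqP; vm_compute.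
Qed.
End Tables.

Lemma card_f4_prod (T : finType) (tp : f4 -> pred T) :
  #|[pred f : f4 * T | tp f.1 f.2]| =
  (#|tp (false, false)| + #|tp one4| + #|tp (false, true)| + #|tp (true, true)|)%N.
Proof.
transitivity (\sum_(c : f4) \sum_(t | tp c t) 1)%N.
  by rewrite pair_big_dep -sum1_card; apply: eq_bigl => -[].
rewrite (eq_bigr (fun c => \sum_(t | tp (c.1, c.2) t) 1)%N); last by case.
rewrite -(pair_bigA _ (fun p q => \sum_(t | tp (p, q) t) 1)%N) /=.
rewrite !big_bool /= !sum1_card.
by rewrite !addnA [LHS](ACl (4*2*3*1)).
Qed.

Lemma addr_regroup (V : zmodType) (a m1 m2 f1 n1 f2 n2 : V) :
  a - m1 - m2 + (f1 + n1) + (f2 + n2) = a + (f1 + f2) + (n1 + n2 - m1 - m2).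
Proof. by rewrite !addrA [LHS](ACl (1*4*6*5*7*2*3))/=. Qed.

Lemma addr_cancel_gap (V : zmodType) (t d a b : V) :
  t + d - (a + b) + (- t + a) + b = d.
Proof.
by rewrite opprD !addrA [LHS](ACl (1*5*2*(3*6)*(4*7)))/= subrr add0r !addNr !addr0.
Qed.

(** * Assembly of the layers with the exchange at [t = 0] *)

Section Orders.
Variables (B : zmodType) (tp : f4 -> pred B) (x y : B) (M N : nat).
Hypotheses (ox : forall i, x *+ i = 0 <-> (M %| i)%N).
Hypotheses (oy : forall i, y *+ i = 0 <-> (N %| i)%N).

Definition target (c : f4) (t : B) : B := if tp c t then x else y.

Lemma target_order c t i : target c t *+ i = 0 <-> ((if tp c t then M else N) %| i)%N.
Proof. by rewrite /target; case: ifP. Qed.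

Lemma sg4_target_order a c t i :
  sg4 a (target c t) *+ i = 0 <-> ((if tp c t then M else N) %| i)%N.
Proof.
rewrite -target_order /sg4; case: a.2; rewrite // mulNrn.
by split=> [/eqP|->]; rewrite ?oppr0 // oppr_eq0 => /eqP.
Qed.
End Orders.

Section Trade.
Variable B : finZmodType.

(** Away from 0, [psi], [phi1] and [phi2] add up to [dl], short of the odd gap where [O] holds. At 0
    they miss it by [j] in class omega and by an uncontrolled amount [th] in class 1; the exchanged
    shifts supply both. *)
Lemma HWP_slot (g v M N : nat) (x y u j : B) (O : pred B) (phi1 phi2 : B -> B)
    (tp : f4 -> pred B) (psi : f4 -> B -> B) :
  let dl := target tp x y in
  (2 < g)%N -> (4 * #|B|)%N = v -> (0 < M)%N -> (0 < N)%N ->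
  (forall i, x *+ i = 0 <-> (M %| i)%N) ->
  (forall i, y *+ i = 0 <-> (N %| i)%N) ->
  injective phi1 -> phi1 0 = 0 -> phi2 0 = 0 ->
  (forall t, phi1 t + phi2 t = - t + (if O t then u else 0)) ->
  (if odd g then injective phi2 else forall t, phi2 t = 0) ->
  (forall c, injective (psi c)) ->
  (forall c t, t != 0 ->
     psi c t = t + dl c t - (if O t then u + odd_gap 0 j u c else 0)) ->
  psi (false, false) 0 = dl (false, false) 0 ->
  psi (false, true) 0 + j = dl (false, true) 0 ->
  psi (true, true) 0 = dl (true, true) 0 ->
  HWP (Cg g v) (g * M) (g * N) #|[pred f : f4 * B | tp f.1 f.2]|
      #|predC [pred f : f4 * B | tp f.1 f.2]|.
Proof.
move=> dl g3 cB M0 N0 ox oy p1i p10 p20 p12 p2g psii hpsi h0 h2 h3.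
pose th := dl one4 0 - psi one4 0.
(* [odd_table] does not involve [th], so the hypothesis on [psi] can have 0 in its place although
   [th] depends on [psi]. *)
have oddE c : odd_gap 0 j u c = odd_gap th j u c.
  by case: c => [[] []]; rewrite /odd_gap /lin3 /= !mulr0z.
pose k1 (c : f4) (t : B) :=
  if t == 0 then om c else if O t then add4 c one4 else c.
pose k2 (c : f4) (t : B) :=
  if t == 0 then om2 c else if O t then add4 c (true, true) else c.
(* The terms [mu1] and [mu2] cancel wherever [k1] and [k2] keep the class [c]. *)
pose G0 a c t := sg4 a (psi c t) - mu1 th j u a c - mu2 th j u a c.
pose G1 a c t := sg4 a (phi1 t) + mu1 th j u a c.
pose G2 a c t := sg4 a (phi2 t) + mu2 th j u a c.
(* For even [g], [phi2] vanishes and [G2] is constant in [t]: it is the sum of [t + mu2] and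
   [- t]. *)
apply: (@HWP_shift_layers B g v M N k1 k2 G0 G1 G2
  (fun a c t => t + mu2 th j u a c) (fun _ _ t => - t)
  (fun a c t => sg4 a (dl c t))) => //.
- by move=> t; rewrite /k1; case: (t == 0); [exact: om_inj|case: (O t); [exact: add4Ir|]].
- by move=> t; rewrite /k2; case: (t == 0); [exact: om2_inj|case: (O t); [exact: add4Ir|]].
- by move=> c t; rewrite /k1 /k2; case: (t == 0); [|case: (O t)]; case: c => [[] []].
- by move=> a c s t /addIr/addIr/sg4_inj/psii.
- by move=> a c s t /addIr/sg4_inj/p1i.
- case: ifP p2g => _ p2g; first by move=> a c s t /addIr/sg4_inj/p2g.
  split=> [a c|a c|a c t]; [exact: addIr|exact: oppr_inj|].
  by rewrite /G2 p2g /sg4 oppr0 if_same add0r addrAC subrr add0r.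
- move=> a c t; rewrite /G0 /G1 /G2 /k1 /k2.
  have [->|t0] := eqVneq t 0.
    have e : dl c 0 = psi c 0 + (phi1 0 + phi2 0) + slot_gap th j u c.
      rewrite p10 p20 !addr0; case: c => [[] []];
        rewrite /slot_gap /lin3 /= !(mulr0z, mulr1z, addr0, add0r) //.
      by rewrite /th addrC subrK.
    have -> : sg4 (add4 (add4 a c) (om c)) (phi1 0) = sg4 a (phi1 0).
      by rewrite p10 /sg4 oppr0 !if_same.
    by rewrite addr_regroup mu_slot e /sg4; case: a.2; rewrite // !opprD.
  have p12t := p12 t; have ht := hpsi c t t0; case: (O t) p12t ht => p12t ht.
    (* The coordinate is [a + 1], and the sign depends only on the coefficient of omega. *)
    have -> : sg4 (add4 (add4 a c) (add4 c one4)) (phi1 t) = sg4 a (phi1 t).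
      by case: (a) (c) => [[] []] [[] []].
    have e : dl c t = psi c t + (phi1 t + phi2 t) + odd_gap th j u c.
      by rewrite ht p12t oddE addr_cancel_gap.
    by rewrite addr_regroup mu_odd e /sg4; case: a.2; rewrite // !opprD.
  have -> : add4 (add4 a c) c = a by case: (a) (c) => [[] []] [[] []].
  have e : dl c t = psi c t + (phi1 t + phi2 t).
    by rewrite ht p12t subr0 addr0 addrAC subrr add0r.
  rewrite addr_regroup e [mu1 _ _ _ _ _ + _ - _]addrAC subrr add0r subrr addr0.
  by rewrite /sg4; case: a.2; rewrite // !opprD.
- by move=> a c t i; apply: sg4_target_order.
Qed.
End Trade.

(** * Cyclic groups: halving and parity *)

Section Cyclic.
Variable w' : nat.
Let w := w'.+1.
Implicit Types t : 'I_w.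

Lemma inZp_mulrn_eq0 p q i : w = (p * q)%N ->
  (inZp q : 'I_w) *+ i = 0 <-> (p %| i)%N.
Proof.
move=> e; have q0 : (0 < q)%N by move: e; rewrite /w; case: q => //; rewrite muln0.
rewrite Zp_mulrn /= -(dvdn_pmul2r q0) [(i * q)%N]mulnC -e.
split=> [/(congr1 val) /= /eqP|h]; first by rewrite modnMml.
by apply: val_inj => /=; rewrite modnMml; apply/eqP.
Qed.

Lemma inZpD a b : inZp a + inZp b = inZp (a + b) :> 'I_w.
Proof. by apply: val_inj; rewrite /= modnDm. Qed.

Lemma Zp_mulrn_card t : t *+ w = 0.
Proof. by rewrite Zp_mulrn; apply: val_inj; rewrite /= modnMl. Qed.

(** [w./2.+1] is (w+1)/2, the inverse of 2 modulo [w]. *)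
Lemma double_half_Zp t : odd w -> t *+ w./2.+1 + t *+ w./2.+1 = t.
Proof.
move=> ow; rewrite -mulrnDr addSn addnS addnn.
have -> : (w./2).*2.+2 = w.+1 by rewrite -[in RHS](odd_double_half w) ow.
by rewrite mulrS Zp_mulrn_card addr0.
Qed.

Lemma double_half_Zp_inj : odd w -> injective (fun t => - (t *+ w./2.+1)).
Proof.
move=> ow s t /oppr_inj e.
by rewrite -(double_half_Zp s ow) e double_half_Zp.
Qed.

Section Even.
Hypothesis w_even : ~~ odd w.

Lemma odd_ZpD s t : odd (s + t)%R = odd s (+) odd t.
Proof. by rewrite /= odd_mod ?oddD // (negbTE w_even). Qed.

Lemma odd_ZpN t : odd (- t)%R = odd t.
Proof.
have : odd (t - t)%R = false by rewrite subrr.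
by rewrite odd_ZpD; case: (odd t); case: (odd _).
Qed.

Lemma odd_inZp a : odd (inZp a : 'I_w) = odd a.
Proof. by rewrite /= odd_mod // (negbTE w_even). Qed.

(** As [s] is even, the image has the parity of [t + p] and tells which of the two translations was
    applied. *)
Lemma odd_shift_inj (p s : 'I_w) : ~~ odd s ->
  injective (fun t => t + p - (if odd t then s else 0)).
Proof.
move=> os t1 t2 e.
have : odd t1 = odd t2.
  have : odd (t1 + p - (if odd t1 then s else 0))%R =
         odd (t2 + p - (if odd t2 then s else 0))%R by rewrite e.
  rewrite !odd_ZpD !odd_ZpN; case: (odd t1); case: (odd t2);
  by rewrite ?(negbTE os) /=; case: (odd p).
by move=> o; move: e; rewrite o => /addIr/addIr.
Qed.

(* Two permutations of a cyclic group of even order never add up to the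
   identity; twice this one is the identity on the even residues only. *)
Definition half_perm t : 'I_w := inZp (t./2 + odd t * w./2).

Lemma val_half_perm t : half_perm t = (t./2 + odd t * w./2)%N :> nat.
Proof. rewrite /= modn_small //; have := ltn_ord t; move: w_even; lia. Qed.

Lemma half_perm_inj : injective half_perm.
Proof.
move=> s t e; have := congr1 (@nat_of_ord w) e; rewrite !val_half_perm => {}e.
apply: val_inj; have := ltn_ord t; have := ltn_ord s; move: w_even e => /=; lia.
Qed.

Lemma half_perm_double t :
  half_perm t + half_perm t = t - (if odd t then inZp 1 else 0).
Proof.
apply/eqP; rewrite eq_sym subr_eq; apply/eqP.
have -> : (if odd t then inZp 1 else 0) = inZp (odd t) :> 'I_w.
  by case: (odd t) => //; apply: val_inj; rewrite /= mod0n.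
rewrite /half_perm !inZpD; apply: val_inj => /=.
have -> : (t./2 + odd t * w./2 + (t./2 + odd t * w./2) + odd t = odd t * w + t)%N.
  by move: w_even; lia.
by rewrite modnMDl modn_small.
Qed.
End Even.

(** * Existence for cyclic B *)

Variables (g M N : nat).
Hypotheses (g3 : (2 < g)%N) (wMN : w = (M * N)%N).

Let M0 : (0 < M)%N. Proof. by move: wMN; rewrite /w; case: M. Qed.
Let N0 : (0 < N)%N. Proof. by move: wMN; rewrite /w; case: N => //; rewrite muln0. Qed.
Let x : 'I_w := inZp N.
Let y : 'I_w := inZp M.
Let ox i : x *+ i = 0 <-> (M %| i)%N. Proof. exact: inZp_mulrn_eq0. Qed.
Let oy i : y *+ i = 0 <-> (N %| i)%N.
Proof. by apply: inZp_mulrn_eq0; rewrite mulnC. Qed.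
Let cB : (4 * #|'I_w|)%N = (4 * w)%N. Proof. by rewrite card_ord. Qed.

Lemma HWP_card_pred alpha (P : pred (f4 * 'I_w)) : #|P| = alpha ->
  HWP (Cg g (4 * w)) (g * M) (g * N) #|P| #|predC P| ->
  HWP (Cg g (4 * w)) (g * M) (g * N) alpha (4 * w - alpha).
Proof.
move=> cP; suff -> : #|predC P| = (4 * w - alpha)%N by rewrite cP.
have e : (#|P| + #|predC P|)%N = (4 * w)%N.
  by rewrite cardC !card_prod card_bool card_ord.
by rewrite -cP -e addKn.
Qed.

Lemma card_predT_if (b : bool) : #|[pred _ : 'I_w | b]| = (b * w)%N.
Proof.
case: b; last by rewrite mul0n; apply: eq_card0.
by rewrite mul1n -[RHS](card_ord w); apply: eq_card.
Qed.

(** Only class 1 is mixed. The term [- t] splits into two equal halves if [g] is odd, 2 being then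
    invertible, and goes entirely to [phi1] if [g] is even. *)
Lemma HWP_cyclic_plain alpha : odd w || ~~ odd g -> (alpha <= 4 * w)%N ->
  HWP (Cg g (4 * w)) (g * M) (g * N) alpha (4 * w - alpha).
Proof.
move=> parity a4.
have [b0 [b2 [b3 [r [rw ea]]]]] : exists b0 b2 b3 : bool, exists r,
    (r <= w)%N /\ alpha = (b0 * w + r + b2 * w + b3 * w)%N.
  have [h|h] := leqP alpha w; first by exists false, false, false, alpha; lia.
  have [h2|h2] := leqP alpha (2 * w).
    by exists true, false, false, (alpha - w)%N; lia.
  have [h3|h3] := leqP alpha (3 * w).
    by exists true, true, false, (alpha - 2 * w)%N; lia.
  by exists true, true, true, (alpha - 3 * w)%N; lia.
have rB : (r <= #|'I_w|)%N by rewrite card_ord.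
have [U [p [cU pi hp]]] := mixed_shift x y rB.
pose tp (c : f4) : pred 'I_w := match c with
  | (false, false) => [pred _ | b0] | (true, false) => [pred t in U]
  | (false, true) => [pred _ | b2] | (true, true) => [pred _ | b3] end.
pose psi (c : f4) t := if c == one4 then p t else t + target tp x y c t.
have psii c : injective (psi c).
  by case: c => [[] []] //=; apply: addIr.
have psi0 c : c != one4 -> psi c 0 = target tp x y c 0.
  by rewrite /psi => /negbTE ->; rewrite add0r.
apply: (@HWP_card_pred _ [pred f : f4 * 'I_w | tp f.1 f.2]).
  by rewrite card_f4_prod /= !card_predT_if cU ea.
pose f1 t : 'I_w := if odd g then - (t *+ w./2.+1) else - t.
pose f2 t : 'I_w := if odd g then - (t *+ w./2.+1) else 0.
apply: (@HWP_slot _ g _ M N x y 0 0 pred0 f1 f2 tp psi) => //.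
- rewrite /f1; move: parity; case: (odd g) => /= [|_]; last exact: oppr_inj.
  by rewrite orbF; apply: double_half_Zp_inj.
- by rewrite /f1; case: (odd g); rewrite ?mul0rn oppr0.
- by rewrite /f2; case: (odd g); rewrite ?mul0rn ?oppr0.
- move=> t; rewrite /f1 /f2 addr0; move: parity; case: (odd g); rewrite ?addr0 //=.
  by rewrite orbF => ow; rewrite -opprD double_half_Zp.
- rewrite /f2; move: parity; case: (odd g) => //=.
  by rewrite orbF; apply: double_half_Zp_inj.
- by move=> c t t0; rewrite subr0 /psi; case: eqP => // ->; rewrite hp.
- exact: psi0.
- by rewrite addr0 psi0.
- exact: psi0.
Qed.

(** * Even [w] and odd [g] *)

Section EvenOdd.
Hypotheses (w_even : ~~ odd w) (g_odd : odd g) (M_odd : odd M).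

Let odd_x : odd x = false.
Proof.
rewrite odd_inZp //; move: w_even; rewrite wMN oddM M_odd.
by case: (odd N).
Qed.
Let odd_y : odd y = true. Proof. by rewrite odd_inZp. Qed.

Let phi t : 'I_w := - half_perm t.
Let phi_inj : injective phi.
Proof. by move=> s t /oppr_inj/(half_perm_inj w_even). Qed.
Let phi0 : phi 0 = 0.
Proof. by rewrite /phi /half_perm -[RHS]oppr0; congr (- _); apply: val_inj; rewrite /= mod0n. Qed.
Let phi_double t : phi t + phi t = - t + (if odd t then inZp 1 else 0).
Proof. by rewrite -opprD half_perm_double // opprB addrC. Qed.

(** At odd [t] two copies of [phi] leave the odd defect [e]. There [k2] adds omega^2 and so flips
    [c.1], which makes [mu] change by [e] or [- e]; the first layer then has to subtract only 0 or
    [e + e], both even. *)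
Lemma HWP_cyclic_pure (b : bool) :
  HWP (Cg g (4 * w)) (g * M) (g * N) (b * (4 * w)) (4 * w - b * (4 * w)).
Proof.
apply: (@HWP_card_pred _ [pred _ : f4 * 'I_w | b]).
  case: b; last by rewrite mul0n; apply: eq_card0.
  by rewrite mul1n -cB -[4%N]/(2 * 2)%N -card_bool -!card_prod; apply: eq_card.
pose O (t : 'I_w) := odd t.
pose e : 'I_w := inZp 1.
pose mu (c : f4) : 'I_w := if c.1 then e else 0.
pose k1 (c : f4) t := if O t then add4 c one4 else c.
pose k2 (c : f4) t := if O t then add4 c (true, true) else c.
pose d : 'I_w := if b then x else y.
pose psi (c : f4) t := t + d - (if odd t then (if c.1 then 0 else e + e) else 0).
apply: (@HWP_shift_layers _ g _ M N k1 k2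
  (fun _ c t => psi c t - mu c) (fun _ _ t => phi t) (fun _ c t => phi t + mu c)
  (fun _ _ _ => 0) (fun _ _ _ => 0) (fun _ _ _ => d)) => //.
- by move=> t; rewrite /k1; case: (O t); [exact: add4Ir|].
- by move=> t; rewrite /k2; case: (O t); [exact: add4Ir|].
- by move=> c t; rewrite /k1 /k2; case: (O t); case: c => [[] []].
- move=> a c s t /addIr; apply: odd_shift_inj => //.
  by case: c.1; rewrite // odd_ZpD //; case: (odd e).
- by rewrite g_odd => a c s t /addIr/phi_inj.
- move=> _ c t; have := phi_double t; rewrite /psi /k2 /O.
  case: (odd t) => h.
    have -> : mu (add4 c (true, true)) = (if c.1 then 0 else e).
      by rewrite /mu /=; case: c.1.
    rewrite addrA -[_ + phi t + phi t]addrA h /mu.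
    case: c.1; rewrite ?subr0 ?addr0.
      by rewrite !addrA [LHS](ACl (2*(1*4)*(3*5)))/= subrr addNr !addr0.
    by rewrite opprD !addrA [LHS](ACl (2*(1*5)*(3*6)*(4*7)))/= subrr !addNr !addr0.
  rewrite subr0 addrA -[_ + phi t + phi t]addrA h addr0.
  by rewrite [LHS](ACl (2*(1*4)*(3*5)))/= subrr addNr !addr0.
- by move=> _ c t i; rewrite /d /=; case: (b).
Qed.

(** [N] is even, so [x] is even and [y] odd. One exceptional factor in class omega makes [j] odd,
    and all corrections at odd [t] become even. *)
Lemma HWP_cyclic_mixed alpha : (0 < alpha < 4 * w)%N ->
  HWP (Cg g (4 * w)) (g * M) (g * N) alpha (4 * w - alpha).
Proof.
move=> /andP[a0 a4].
have w2 : (1 < w)%N by move: w_even; rewrite /w; case: (w').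
(* Class omega contributes 1 or [w.-1] factors of the first type, class 1 contributes [r], and the
   others 0 or [w] each. *)
have [b0 [b2 [b3 [r [rw ea]]]]] : exists b0 b2 b3 : bool, exists r,
    (r <= w)%N /\
    alpha = (b0 * w + r + (if b2 then w.-1 else 1) + b3 * w)%N.
  have [h|h] := leqP alpha (w + 1).
    by exists false, false, false, (alpha - 1)%N; lia.
  have [h2|h2] := leqP alpha (2 * w + 1).
    by exists true, false, false, (alpha - (w + 1))%N; lia.
  have [h3|h3] := leqP alpha (3 * w + 1).
    by exists true, false, true, (alpha - (2 * w + 1))%N; lia.
  by exists true, true, true, (alpha - (3 * w - 1))%N; lia.
have rB : (r <= #|'I_w|)%N by rewrite card_ord.
have [U [p [cU pi hp]]] := mixed_shift x y rB.
pose tp (c : f4) : pred 'I_w := match c with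
  | (false, false) => [pred _ | b0] | (true, false) => [pred t in U]
  | (false, true) => [pred t | (t == 0) (+) b2] | (true, true) => [pred _ | b3] end.
pose e : 'I_w := inZp 1.
pose q : 'I_w := if b2 then x else y.
(* The value at [t = 0] in class omega minus the value [q] taken elsewhere in that class. *)
pose j : 'I_w := if b2 then y - x else x - y.
pose pc (c : f4) : 'I_w := match c with
  | (false, true) => q | (true, true) => if b3 then x else y
  | _ => if b0 then x else y end.
pose s (c : f4) := e + odd_gap 0 j e c.
pose psi (c : f4) t :=
  if c == one4 then p t else t + pc c - (if odd t then s c else 0).
have gapE c : odd_gap 0 j e c = match c with
    | (_, false) => - e | (false, true) => j | (true, true) => e *+ 2 - j end.
  by case: c => [[] []];
    rewrite /odd_gap /lin3 /= !(mulr0z, mul0rz, mulr1z, add0r, addr0, mulrN1z) // addrC.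
have odd_e : odd e by rewrite odd_inZp.
have odd_j : odd j by rewrite /j; case: (b2); rewrite odd_ZpD // odd_ZpN // odd_x odd_y.
have even_s c : ~~ odd (s c).
  rewrite /s gapE; case: c => [[] []]; rewrite ?subrr //; last by rewrite odd_ZpD // odd_e odd_j.
  by rewrite mulr2n !(odd_ZpD, odd_ZpN) // odd_e odd_j.
have psii c : injective (psi c).
  rewrite /psi; case: eqP => _ //; exact: odd_shift_inj.
have psi0 c : c != one4 -> psi c 0 = pc c.
  by rewrite /psi => /negbTE -> /=; rewrite subr0 add0r.
apply: (@HWP_card_pred _ [pred f : f4 * 'I_w | tp f.1 f.2]).
  rewrite card_f4_prod /= !card_predT_if cU ea; congr (_ + _ + _)%N.
  case: (b2).
    transitivity #|predC1 (0 : 'I_w)|; last by rewrite cardC1 card_ord.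
    apply: eq_card => t.
    by rewrite !inE addbT.
  by rewrite -(card1 (0 : 'I_w)); apply: eq_card => t; rewrite !inE addbF.
apply: (@HWP_slot _ g _ M N x y e j (fun t : 'I_w => odd t) phi phi tp psi) => //.
- by rewrite g_odd.
- move=> c t t0; rewrite -/(s c) /psi; case: eqP => [->|nc].
    by rewrite hp // /s gapE /= subrr if_same subr0.
  congr (_ + _ - _); rewrite /target; case: c nc => [[] []] // _.
  by rewrite /tp /pc /q /= (negbTE t0).
- exact: psi0.
- by rewrite psi0 // /target /= /q /j; case: (b2); rewrite /= addrC subrK.
- exact: psi0.
Qed.
End EvenOdd.

Lemma HWP_cyclic alpha : odd M -> (alpha <= 4 * w)%N ->
  HWP (Cg g (4 * w)) (g * M) (g * N) alpha (4 * w - alpha).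
Proof.
move=> Mo a4; have [h|] := boolP (odd w || ~~ odd g); first exact: HWP_cyclic_plain.
rewrite negb_or negbK => /andP[we go].
have [->|a0] := posnP alpha; first by have := HWP_cyclic_pure we go false.
have [h|h] := ltnP alpha (4 * w); first by apply: HWP_cyclic_mixed => //; rewrite a0.
have -> : alpha = (true * (4 * w))%N by apply/eqP; rewrite mul1n eqn_leq a4.
exact: HWP_cyclic_pure.
Qed.
End Cyclic.


Local Close Scope ring_scope.

Theorem mainTheorem16 (g k m n alpha beta : nat) :
  3 <= g -> odd m -> odd n ->
  (HWP (Cg g (2 ^ (k + 2) * m * n)) (g * m) (2 ^ k * g * n) alpha beta
   <-> alpha + beta = 2 ^ (k + 2) * m * n).
Proof.
move=> g3 om on.
have m0 : 0 < m by case: m om.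
have n0 : 0 < n by case: n on.
(* The construction is applied with [M = m], [N = 2 ^ k * n] and [w = M * N]. *)
have w0 : 0 < m * (2 ^ k * n) by rewrite !muln_gt0 m0 n0 expn_gt0.
have -> : 2 ^ (k + 2) * m * n = 4 * (m * (2 ^ k * n)).
  by rewrite expnD; lia.
have -> : 2 ^ k * g * n = g * (2 ^ k * n) by lia.
split=> [|e]; first by apply: HWP_Cg_card; rewrite // muln_gt0.
have -> : beta = 4 * (m * (2 ^ k * n)) - alpha by rewrite -e addKn.
move: w0 e; case ew: (m * (2 ^ k * n)) => [//|w'] _ e.
by apply: HWP_cyclic; rewrite -?e ?leq_addr.
Qed.
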